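(* Let $a$ and $b$ be coprime natural numbers, and let $t$ be a natural number such that $a^2+1\equiv 0 \pmod t$ and $\gcd(b,t)=1$. Let $a^*$ be an integer with $aa^*\equiv 1 \pmod b$ and $b^*$ an integer with $bb^*\equiv 1\pmod a$. Then \[ S(ta^*,b)+S(tb^*,a)=\frac{a^2+b^2+t^2}{tab}-3+S(ab,t). \]
   Context: For $x\in\mathbb{R}$ let $((x))=x-\lfloor x\rfloor-1/2$ if $x\notin\mathbb{Z}$ and $((x))=0$ if $x\in\mathbb{Z}$. For an integer $a$ and a natural number $b$ with $\gcd(a,b)=1$, the classical Dedekind sum is $s(a,b)=\sum_{k=1}^{b}((k/b))((ak/b))$, and the normalized Dedekind sum is $S(a,b)=12\,s(a,b)$. (Note $S(a,b)$ depends only on $a$ modulo $b$, so the choice of the inverses $a^*,b^*$ does not matter.) *)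

(* Defs.v *)
From mathcomp Require Import all_boot all_order all_algebra.
From mathcomp Require Import reals.

Set Implicit Arguments.
Unset Strict Implicit.
Unset Printing Implicit Defensive.

Import Order.TTheory GRing.Theory Num.Theory.
Local Open Scope ring_scope.

Definition sawtooth (R : realType) (x : R) : R :=
  if x \is a Num.int then 0 else x - (Num.floor x)%:~R - 2^-1.

(* The definition is total; it is the classical Dedekind sum when b > 0 and
   a is coprime to b. *)
Definition dedekind_sum (R : realType) (a : int) (b : nat) : R :=
  \sum_(1 <= k < b.+1)
    sawtooth (k%:R / b%:R) * sawtooth (a%:~R * k%:R / b%:R).

Definition dedekind_S (R : realType) (a : int) (b : nat) : R :=
  12 * dedekind_sum R a b.

(* Main.v *)
Require Import Defs.
From mathcomp Require Import all_boot all_order all_algebra.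
From mathcomp Require Import reals.
From mathcomp Require Import ring lra zify.

Set Implicit Arguments.
Unset Strict Implicit.
Unset Printing Implicit Defensive.

Import Order.TTheory GRing.Theory Num.Theory.
Local Open Scope ring_scope.

(** Distributing ((bx)) = sum_j ((x - j/b)) turns sum_k ((bk/a)) ((ck/a)) into
    a sum over triples (k, j, l) of ((k/a - j/b)) ((k/a - l/c)). Put x = k/a - j/b,
    y = j/b - l/c and z = l/c - k/a. The three such sums attached to a, b and c
    add up to minus the sum of ((x))((y)) + ((y))((z)) + ((z))((x)), which is read
    off from the square of ((x)) + ((y)) + ((z)); since x + y + z = 0, this square
    is 1/4, or 0 when one of x, y, z is an
    integer. The sums of ((x))^2 are evaluated by the Chinese remainder theorem,
    which gives Rademacher's three-term law. For c = t, the substitution k -> ak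
    (or bk) identifies two of the sums with those of the theorem, and
    a^2 = -1 mod t identifies the third one with -S(ab, t). *)

(** * Sums of periodic functions over a complete residue system *)

Section Periodic.
Variables (V : zmodType) (n : nat) (f : int -> V).
Hypotheses (n_gt0 : (0 < n)%N) (f_per : forall m, f (m + n%:Z) = f m).

Lemma periodic_mulz (m q : int) : f (m + q * n%:Z) = f m.
Proof.
have fN r i : f (r + i%:Z * n%:Z) = f r.
  by elim: i r => [|i IHi] r; [rewrite mul0r addr0 | rewrite intS mulrDl mul1r addrA IHi].
case: q => i; first exact: fN.
by rewrite NegzE -(fN _ i.+1) -addrA -mulrDl addNr mul0r addr0.
Qed.

(** As [u] is a unit mod [n], the map k -> uk + v permutes the residues mod [n]. *)
Lemma sum_periodic_affine (u v : int) : coprime `|u| n ->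
  \sum_(k < n) f (u * k%:Z + v) = \sum_(k < n) f k%:Z.
Proof.
move=> co_un; case: n n_gt0 co_un periodic_mulz => // n' _ co_un f_mod.
have n0 : n'.+1%:Z != 0 by [].
pose h (k : 'I_n'.+1) : 'I_n'.+1 := inord `|((u * k%:Z + v) %% n'.+1%:Z)%Z|.
have hE k : (h k)%:Z = ((u * k%:Z + v) %% n'.+1%:Z)%Z.
  rewrite inordK; first by rewrite gez0_abs ?modz_ge0.
  by rewrite -ltz_nat gez0_abs ?modz_ge0 // ltz_mod.
have h_inj : injective h.
  move=> i j /(congr1 (fun k : 'I_n'.+1 => k%:Z)); rewrite !hE => /eqP.
  rewrite eqz_mod_dvd opprD addrACA subrr addr0 -mulrBr Gauss_dvdzr; last by rewrite coprimezE coprime_sym.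
  rewrite -eqz_mod_dvd !modz_small ?lez_nat ?ltz_nat ?ltn_ord //.
  by move=> /eqP[] /ord_inj.
rewrite [RHS](reindex_inj h_inj); apply: eq_bigr => k _.
by rewrite hE {1}(divz_eq (u * k%:Z + v) n'.+1%:Z) addrC f_mod.
Qed.

End Periodic.

(** * Chinese remaindering for periodic sums *)

Section Crt.
Variables (V : zmodType) (a b : nat) (f : int -> V).
Hypotheses (a_gt0 : (0 < a)%N) (b_gt0 : (0 < b)%N) (co_ab : coprime a b).
Hypothesis f_per : forall m, f (m + (a * b)%N%:Z) = f m.

(** The inner sum over k depends on -aj only modulo b, and a is a unit mod b, so -aj may be replaced
    by j. Then bk + j runs through 0, ..., ab - 1 by division with remainder by b. *)
Lemma sum_periodic_crt :
  \sum_(k < a) \sum_(j < b) f (b%:Z * k%:Z - a%:Z * j%:Z) =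
  \sum_(m < a * b) f m%:Z.
Proof.
pose g (r : int) := \sum_(k < a) f (b%:Z * k%:Z + r).
have g_per r : g (r + b%:Z) = g r.
  have fb_per m : f (b%:Z * (m + a%:Z) + r) = f (b%:Z * m + r).
    by rewrite -(f_per (b%:Z * m + r)) PoszM; congr f; ring.
  rewrite /g; have <- := sum_periodic_affine a_gt0 fb_per (u := 1) 1 (coprime1n a).
  by apply: eq_bigr => k _; congr f; ring.
rewrite exchange_big /=.
transitivity (\sum_(j < b) g (- a%:Z * j%:Z + 0)).
  by apply: eq_bigr => j _; apply: eq_bigr => k _; congr f; ring.
rewrite (sum_periodic_affine b_gt0 g_per); last by rewrite abszN.
rewrite -[RHS](big_mkord xpredT (fun m : nat => f m%:Z)) big_nat_mul big_mkord exchange_big /=.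
apply: eq_bigr => k _.
rewrite mulSn -[X in \sum_(X <= _ < _) _]add0n big_addn addnK big_mkord.
by apply: eq_bigr => j _; congr f; rewrite !PoszD PoszM; ring.
Qed.

End Crt.

(** * The sawtooth function *)

Section Sawtooth.
Variable R : realType.
Implicit Types (x y z : R) (m : int).
Local Notation s := (@sawtooth R).

Lemma sawtooth_int x : x \is a Num.int -> s x = 0.
Proof. by rewrite /sawtooth => ->. Qed.

Lemma sawtooth_itv x : 0 < x < 1 -> s x = x - 2^-1.
Proof.
move=> x01; have f0 : Num.floor x = 0.
  by apply: floor_def; rewrite mulr0z add0r; lra.
by rewrite /sawtooth intrEfloor f0 mulr0z subr0; case: eqP => // xE; lra.
Qed.

Lemma sawtoothDz x m : s (x + m%:~R) = s x.
Proof.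
rewrite /sawtooth rpredDr ?intr_int //; case: ifP => // _.
by rewrite floorDrz ?intr_int // intrKfloor intrD; ring.
Qed.

Lemma floor_itv_int x : x \isn't a Num.int ->
  (Num.floor x)%:~R < x < (Num.floor x)%:~R + 1.
Proof.
by rewrite intrEfloor lt_neqAle => ->; have := floor_itv x; rewrite intrD.
Qed.

Lemma sawtoothN x : s (- x) = - s x.
Proof.
have [xi | xni] := boolP (x \is a Num.int); first by rewrite !sawtooth_int ?oppr0 ?rpredN.
have := floor_itv_int xni; set m := Num.floor x => xm.
(* Both x - m and -x + m + 1 lie in the open unit interval, and their sum is 1. *)
rewrite -(sawtoothDz x (- m)) -(sawtoothDz (- x) (m + 1)) intrN intrD.
by rewrite !sawtooth_itv; lra.
Qed.

(** Writing the exceptional value at 0 as a summand lets sums over fractions in [0, 1) be computed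
    as power sums plus one correction. *)
Lemma sawtooth_itv0 x : 0 <= x < 1 -> s x = x - 2^-1 + (x == 0)%:R / 2.
Proof.
have [-> | x0] := eqVneq x 0; first by rewrite sawtooth_int ?rpred0 // sub0r mul1r addNr.
by rewrite le0r (negPf x0) => x01; rewrite sawtooth_itv // mul0r addr0.
Qed.

(* The fractional parts of three non-integers with integral sum add up to
   1 or 2, hence the sawtooth values add up to 1/2 or -1/2. *)
Lemma sawtooth_sum3_sqr x y z : x + y + z = 0 ->
  let p : R := (x \is a Num.int)%:R in
  let q : R := (y \is a Num.int)%:R in
  let r : R := (z \is a Num.int)%:R in
  (s x + s y + s z) ^+ 2 = (1 - p - q - r + 2 * (p * q * r)) / 4.
Proof.
have sDint u v : u \is a Num.int -> s (u + v) = s v.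
  by move=> /intrP[m ->]; rewrite addrC sawtoothDz.
move=> xyz0; have -> : z = - (x + y) by lra.
rewrite sawtoothN rpredN /=.
have [xi | xni] := boolP (x \is a Num.int).
  by rewrite sDint // rpredDl // (sawtooth_int xi); case: (y \is a Num.int) => /=; field.
have [yi | yni] := boolP (y \is a Num.int).
  by rewrite [x + y]addrC sDint // rpredDl // (negPf xni) (sawtooth_int yi) /=; field.
have [zi | zni] := boolP (x + y \is a Num.int).
  have -> : s y = - s x by rewrite -sawtoothN -(sDint _ (- x) zi); congr s; ring.
  by rewrite (sawtooth_int zi) /=; field.
have := floor_itv_int zni; have := floor_itv_int yni; have := floor_itv_int xni.
rewrite /sawtooth (negPf xni) (negPf yni) (negPf zni).
set i := Num.floor x; set j := Num.floor y; set k := Num.floor _ => xi yj zk.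
have kE : (k == i + j) || (k == i + j + 1).
  have : k < i + j + 2 by rewrite -(ltr_int R) !intrD; lra.
  have : i + j < k + 1 by rewrite -(ltr_int R) !intrD; lra.
  by lia.
by case/orP: kE => /eqP ->; rewrite !intrD /=; field.
Qed.

(** * Evaluation of sawtooth sums over equally spaced points *)

Lemma sum_affine (n : nat) (c d : R) :
  \sum_(k < n) (c * k%:R + d) = c * (n%:R * (n%:R - 1) / 2) + n%:R * d.
Proof.
elim: n => [|n IHn]; first by rewrite big_ord0; field.
by rewrite big_ord_recr /= IHn -natr1; field.
Qed.

Lemma sum_affine_sqr (n : nat) (c d : R) :
  \sum_(k < n) (c * k%:R + d) ^+ 2 =
  c ^+ 2 * (n%:R * (n%:R - 1) * (2 * n%:R - 1) / 6)
    + c * d * (n%:R * (n%:R - 1)) + n%:R * d ^+ 2.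
Proof.
elim: n => [|n IHn]; first by rewrite big_ord0; field.
by rewrite big_ord_recr /= IHn -natr1; field.
Qed.

(** With y = -bx, each x - j/b is -(y + j)/b. By periodicity in j, y may be replaced by its
    fractional part r, which brings every (r + j)/b into [0, 1). What remains is an arithmetic
    progression, corrected by 1/2 when r = 0, at j = 0 only. *)
Lemma sawtooth_distribution x (b : nat) : (0 < b)%N ->
  \sum_(j < b) s (x - j%:R / b%:R) = s (b%:R * x).
Proof.
move=> b_gt0; have b0 : b%:R != 0 :> R by rewrite pnatr_eq0 -lt0n.
pose y := - (b%:R * x); pose r := y - (Num.floor y)%:~R.
have r01 : 0 <= r < 1 by have := floor_itv y; rewrite /r intrD; lra.
pose f (m : int) := s ((r + m%:~R) / b%:R).
have f_per m : f (m + b%:Z) = f m.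
  rewrite /f intrD addrA mulrDl divff // -[X in _ + X]/(1%:~R) sawtoothDz //.
transitivity (- \sum_(j < b) f (1 * j%:Z + Num.floor y)).
  rewrite -sumrN; apply: eq_bigr => j _; rewrite -sawtoothN; congr s.
  rewrite intrD mul1r /r /y -pmulrn; field.
  exact: b0.
rewrite sum_periodic_affine ?coprime1n //.
rewrite -[b%:R * x]opprK sawtoothN -/y -(sawtoothDz y (- Num.floor y)) intrN -/r; congr (- _).
clearbody r; clear y.
have nz j : ((r + j%:R) / b%:R == 0) = (r == 0) && (j == 0)%N.
  by rewrite mulf_eq0 invr_eq0 (negPf b0) orbF paddr_eq0 ?ler0n ?pnatr_eq0 //; case/andP: r01.
transitivity (\sum_(j < b) (b%:R^-1 * j%:R + (r / b%:R - 2^-1)) +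
              \sum_(j < b) ((r == 0) && (j == 0 :> nat)%N)%:R / 2).
  rewrite -big_split; apply: eq_bigr => j _; rewrite /f sawtooth_itv0 ?nz -?pmulrn.
    by rewrite [_^-1 * _]mulrC [in LHS]mulrDl /=; ring.
  rewrite divr_ge0 ?addr_ge0 ?ler0n //= ?ltr_pdivrMr ?ltr0n //; last by case/andP: r01.
  have : j.+1%:R <= b%:R :> R by rewrite ler_nat.
  by rewrite -natr1; lra.
rewrite sum_affine sawtooth_itv0 //; clear f f_per nz; case: b b_gt0 b0 => // b' _ b0.
rewrite big_ord_recl big1 => [|i _]; last by rewrite andbF mul0r.
by rewrite eqxx andbT; move: b'.+1%:R b0 => B B0; field.
Qed.

Lemma sum_sawtooth_sqr (n : nat) : (0 < n)%N ->
  \sum_(m < n) s (m%:R / n%:R) ^+ 2 = (n%:R - 1) * (n%:R - 2) / (12 * n%:R).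
Proof.
move=> n_gt0; have n0 : n%:R != 0 :> R by rewrite pnatr_eq0 -lt0n.
(* At m = 0 the sawtooth vanishes while the affine formula gives (-1/2)^2, hence the correction
   1/4. *)
transitivity (\sum_(m < n) (((n%:R^-1 : R) * m%:R - 2^-1) ^+ 2 - (m == 0 :> nat)%N%:R / 4)).
  apply: eq_bigr => m _; rewrite sawtooth_itv0.
    rewrite mulf_eq0 invr_eq0 (negPf n0) orbF pnatr_eq0.
    by case: eqP => [->|_] /=; field.
  by rewrite divr_ge0 ?ler0n //= ltr_pdivrMr ?ltr0n // mul1r ltr_nat.
rewrite sumrB sum_affine_sqr; case: n n_gt0 n0 => // n' _ n0.
rewrite big_ord_recl big1 => [|i _]; last by rewrite mul0r.
by rewrite eqxx /=; move: n'.+1%:R n0 => N N0; field.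
Qed.

Lemma sawtooth_modz (n : nat) (i j : int) : (0 < n)%N -> (i = j %[mod n%:Z])%Z ->
  s (i%:~R / n%:R) = s (j%:~R / n%:R).
Proof.
move=> n_gt0 /eqP; rewrite eqz_mod_dvd => /dvdzP[q ijE].
have n0 : n%:R != 0 :> R by rewrite pnatr_eq0 -lt0n.
rewrite -[RHS](sawtoothDz _ q); congr s.
have -> : i = j + q * n%:Z by rewrite -ijE; ring.
by rewrite intrD intrM -pmulrn; field.
Qed.

(** The difference lies strictly between -1 and 1, so if integral it is 0. Then kb = ja, and
    coprimality gives a | k and b | j, which the ranges of k and j allow only at 0. *)
Lemma subr_frac_int (a b : nat) (k : 'I_a) (j : 'I_b) : coprime a b ->
  ((k%:R / a%:R - j%:R / b%:R : R) \is a Num.int) = (k == 0 :> nat)%N && (j == 0 :> nat)%N.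
Proof.
have a_gt0 : (0 < a)%N by apply: leq_ltn_trans (ltn_ord k).
have b_gt0 : (0 < b)%N by apply: leq_ltn_trans (ltn_ord j).
have a0 : a%:R != 0 :> R by rewrite pnatr_eq0 -lt0n.
have b0 : b%:R != 0 :> R by rewrite pnatr_eq0 -lt0n.
move=> co_ab; apply/idP/andP => [|[/eqP-> /eqP->]]; last by rewrite !mul0r subrr.
have k01 : 0 <= (k%:R / a%:R : R) < 1.
  by rewrite divr_ge0 ?ler0n //= ltr_pdivrMr ?ltr0n // mul1r ltr_nat.
have j01 : 0 <= (j%:R / b%:R : R) < 1.
  by rewrite divr_ge0 ?ler0n //= ltr_pdivrMr ?ltr0n // mul1r ltr_nat.
move=> /intrP[m mE]; have m0 : m = 0.
  have : m < 1 by rewrite -(ltr_int R) -mE; lra.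
  have : -1 < m by rewrite -(ltr_int R) -mE intrN; lra.
  by lia.
have kbE : (k * b = j * a)%N.
  apply/eqP; rewrite -(eqr_nat R) !natrM.
  by rewrite -eqr_div //; apply/eqP/subr0_eq; rewrite mE m0.
have ak : (a %| k)%N by rewrite -(Gauss_dvdl _ co_ab) kbE dvdn_mull.
have bj : (b %| j)%N by rewrite coprime_sym in co_ab; rewrite -(Gauss_dvdl _ co_ab) -kbE dvdn_mull.
by split; rewrite -leqn0 leqNgt; apply/negP => /dvdn_leq;
  [move/(_ _ ak) | move/(_ _ bj)]; rewrite leqNgt ltn_ord.
Qed.

Lemma sum_subr_frac_int (a b : nat) : (0 < a)%N -> (0 < b)%N -> coprime a b ->
  \sum_(k < a) \sum_(j < b) ((k%:R / a%:R - j%:R / b%:R : R) \is a Num.int)%:R = 1 :> R.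
Proof.
move=> a_gt0 b_gt0 co_ab; rewrite pair_bigA (bigD1 (Ordinal a_gt0, Ordinal b_gt0)) //.
rewrite big1 => [|[k j]]; first by rewrite subr_frac_int //= addr0.
by rewrite subr_frac_int // xpair_eqE -!val_eqE /= => /negPf->.
Qed.

(** The numerators bk - aj over the common denominator ab represent each residue mod ab once, which
    reduces the double sum to [sum_sawtooth_sqr]. *)
Lemma sum_sawtooth_subr_sqr (a b : nat) : (0 < a)%N -> (0 < b)%N -> coprime a b ->
  \sum_(k < a) \sum_(j < b) s (k%:R / a%:R - j%:R / b%:R) ^+ 2 =
  ((a * b)%:R - 1) * ((a * b)%:R - 2) / (12 * (a * b)%:R).
Proof.
move=> a_gt0 b_gt0 co_ab; have ab_gt0 : (0 < a * b)%N by rewrite muln_gt0 a_gt0.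
have a0 : a%:R != 0 :> R by rewrite pnatr_eq0 -lt0n.
have b0 : b%:R != 0 :> R by rewrite pnatr_eq0 -lt0n.
rewrite -sum_sawtooth_sqr //.
rewrite -(@sum_periodic_crt _ a b (fun m => s (m%:~R / (a * b)%:R) ^+ 2)) //.
  apply: eq_bigr => k _; apply: eq_bigr => j _; congr (s _ ^+ 2).
  by rewrite intrB !intrM -!pmulrn natrM; field; rewrite ?a0 ?b0.
by move=> m; congr (_ ^+ 2); apply: sawtooth_modz => //; rewrite modzDr.
Qed.

(** * Rademacher's three-parameter Dedekind sums and their reciprocity law *)

Definition rademacher_sum (n u v : nat) : R :=
  \sum_(k < n) s (u%:R * (k%:R / n%:R)) * s (v%:R * (k%:R / n%:R)).

Lemma rademacher_sumE (n u v : nat) : (0 < u)%N -> (0 < v)%N ->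
  rademacher_sum n u v =
  \sum_(k < n) \sum_(j < u) \sum_(l < v)
    s (k%:R / n%:R - j%:R / u%:R) * s (k%:R / n%:R - l%:R / v%:R).
Proof.
move=> u_gt0 v_gt0; apply: eq_bigr => k _.
by rewrite -!sawtooth_distribution // big_distrlr.
Qed.

Lemma rademacher_reciprocity (a b c : nat) :
  (0 < a)%N -> (0 < b)%N -> (0 < c)%N ->
  coprime a b -> coprime b c -> coprime a c ->
  rademacher_sum a b c + rademacher_sum b a c + rademacher_sum c a b =
  (a%:R ^+ 2 + b%:R ^+ 2 + c%:R ^+ 2) / (12 * a%:R * b%:R * c%:R) - 4^-1.
Proof.
move=> a_gt0 b_gt0 c_gt0 co_ab co_bc co_ac.
have a0 : a%:R != 0 :> R by rewrite pnatr_eq0 -lt0n.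
have b0 : b%:R != 0 :> R by rewrite pnatr_eq0 -lt0n.
have c0 : c%:R != 0 :> R by rewrite pnatr_eq0 -lt0n.
pose T (F : 'I_a -> 'I_b -> 'I_c -> R) := \sum_p F p.1.1 p.1.2 p.2.
have TE F : \sum_(k < a) \sum_(j < b) \sum_(l < c) F k j l = T F.
  by rewrite pair_bigA pair_bigA.
pose x k j : R := (k : 'I_a)%:R / a%:R - (j : 'I_b)%:R / b%:R.
pose y j l : R := (j : 'I_b)%:R / b%:R - (l : 'I_c)%:R / c%:R.
(* This is -z for the z of the overview, so the relation reads x + y - w = 0. *)
pose w k l : R := (k : 'I_a)%:R / a%:R - (l : 'I_c)%:R / c%:R.
(* A summand that ignores one index is counted once for each value of that index. *)
have Tab g : T (fun k j l => g k j) = c%:R * \sum_(k < a) \sum_(j < b) g k j.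
  rewrite -TE mulr_sumr; apply: eq_bigr => k _; rewrite mulr_sumr.
  by apply: eq_bigr => j _; rewrite sumr_const card_ord mulr_natl.
have Tbc g : T (fun k j l => g j l) = a%:R * \sum_(j < b) \sum_(l < c) g j l.
  by rewrite -TE sumr_const card_ord mulr_natl.
have Tac g : T (fun k j l => g k l) = b%:R * \sum_(k < a) \sum_(l < c) g k l.
  rewrite -TE mulr_sumr; apply: eq_bigr => k _.
  by rewrite sumr_const card_ord mulr_natl.
have Da : rademacher_sum a b c = T (fun k j l => s (x k j) * s (w k l)).
  by rewrite rademacher_sumE // TE.
have Db : rademacher_sum b a c = T (fun k j l => - s (x k j) * s (y j l)).
  rewrite rademacher_sumE // exchange_big TE; apply: eq_bigr => p _.
  by rewrite -sawtoothN opprB.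
have Dc : rademacher_sum c a b = T (fun k j l => s (w k l) * s (y j l)).
  rewrite rademacher_sumE // exchange_big; under eq_bigr do rewrite exchange_big.
  rewrite TE; apply: eq_bigr => p _.
  by rewrite -[s (w _ _)]opprK -[s (y _ _)]opprK mulrNN -!sawtoothN !opprB.
pose I (z : R) : R := (z \is a Num.int)%:R.
(* This is [sawtooth_sum3_sqr] summed over all triples. Among x, y and w either none, exactly one or
   all three are integers; the triple product accounts for the last case. *)
have key : T (fun k j l => s (x k j) ^+ 2) + T (fun k j l => s (y j l) ^+ 2)
    + T (fun k j l => s (w k l) ^+ 2)
    - 2 * (rademacher_sum a b c + rademacher_sum b a c + rademacher_sum c a b) =
    (T (fun _ _ _ => 1) - T (fun k j l => I (x k j)) - T (fun k j l => I (y j l))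
     - T (fun k j l => I (w k l)) + 2 * T (fun k j l => I (x k j) * I (y j l) * I (w k l))) / 4.
  rewrite Da Db Dc /T -!big_split mulr_sumr -sumrB mulr_sumr -!sumrB -big_split mulr_suml.
  apply: eq_bigr => p _ /=.
  have xyz : x p.1.1 p.1.2 + y p.1.2 p.2 + - w p.1.1 p.2 = 0 by rewrite /x /y /w; ring.
  have := sawtooth_sum3_sqr xyz; rewrite rpredN sawtoothN => xyzE.
  by rewrite -[RHS]xyzE; ring.
have T1 : T (fun _ _ _ => 1) = a%:R * b%:R * c%:R.
  by rewrite /T sumr_const !card_prod !card_ord !natrM.
(* Only the triple k = j = l = 0 contributes. It is the source of the constant -1/4 in the law, as
   the terms in abc and a + b + c cancel. *)
have TI : T (fun k j l => I (x k j) * I (y j l) * I (w k l)) = 1.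
  rewrite /T (bigD1 (Ordinal a_gt0, Ordinal b_gt0, Ordinal c_gt0)) // big1.
    by rewrite /I !subr_frac_int //= !mulr1 addr0.
  move=> [[k j] l] /=; rewrite /I !subr_frac_int // !xpair_eqE -!val_eqE /=.
  by case: eqP; case: eqP; case: eqP => //= *; rewrite ?mulr0 ?mul0r.
move: key; rewrite T1 TI Tab Tbc Tac Tab Tbc Tac.
rewrite !sum_sawtooth_subr_sqr ?sum_subr_frac_int // !natrM.
set D := rademacher_sum _ _ _ + _ + _; clearbody D.
set P := (X in X - _ = _); set Q := (X in _ = X) => PQ.
have {PQ} -> : D = (P - Q) / 2 by rewrite -PQ; field.
by rewrite /P /Q; move: a%:R b%:R c%:R a0 b0 c0 => A B C A0 B0 C0; field; rewrite A0 B0 C0.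
Qed.

(** Substituting k -> uk, a permutation of the residues mod n, turns the factor with zk into one
    with uzk, that is vk mod n. *)
Lemma dedekind_sum_rademacher (n u v : nat) (z : int) :
  (0 < n)%N -> coprime u n -> (u%:Z * z = v%:Z %[mod n%:Z])%Z ->
  dedekind_sum R z n = rademacher_sum n u v.
Proof.
move=> n_gt0 co_un uzv; pose f (k : int) := s (k%:~R / n%:R) * s ((z * k)%:~R / n%:R).
have f_per k : f (k + n%:Z) = f k.
  by congr (_ * _); apply: sawtooth_modz => //; rewrite ?mulrDr addrC ?modzMDl ?modzDl.
(* The range 1..n may be exchanged for 0..n-1 because the terms at 0 and n both vanish. *)
transitivity (\sum_(k < n) f k%:Z).
  transitivity (\sum_(1 <= k < n.+1) f k%:Z).
    by apply: eq_bigr => k _; rewrite /f intrM.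
  have f0 : f 0 = 0 by rewrite /f mul0r sawtooth_int ?rpred0 // mul0r.
  rewrite big_nat_recr // -[X in f X]add0r f_per f0 /= addr0.
  by rewrite -(big_mkord xpredT (fun k : nat => f k%:Z)) [RHS]big_ltn // f0 add0r.
rewrite -(sum_periodic_affine n_gt0 f_per (u := u%:Z) 0) // /rademacher_sum; apply: eq_bigr => k _.
have -> : f (u%:Z * k%:Z + 0) = s ((u%:Z * k%:Z)%:~R / n%:R) * s ((v%:Z * k%:Z)%:~R / n%:R).
  rewrite addr0; congr (_ * _); apply: sawtooth_modz => //.
  by rewrite mulrA [z * _]mulrC -modzMml uzv modzMml.
by rewrite !intrM !mulrA.
Qed.

Lemma dedekind_sumN (n : nat) (z : int) : dedekind_sum R (- z) n = - dedekind_sum R z n.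
Proof.
rewrite /dedekind_sum -sumrN; apply: eq_bigr => k _.
by rewrite intrN !mulNr sawtoothN mulrN.
Qed.

End Sawtooth.

Theorem theorem1 (R : realType) (a b t : nat) (astar bstar : int)
    (a_gt0 : (0 < a)%N) (b_gt0 : (0 < b)%N) (t_gt0 : (0 < t)%N)
    (coprime_ab : coprime a b)
    (a2_mod_t : (a ^ 2 + 1 = 0 %[mod t])%N)
    (coprime_bt : coprime b t)
    (astarP : (a%:Z * astar = 1 %[mod b%:Z])%Z)
    (bstarP : (b%:Z * bstar = 1 %[mod a%:Z])%Z) :
  dedekind_S R (t%:Z * astar) b + dedekind_S R (t%:Z * bstar) a =
    (a%:R ^+ 2 + b%:R ^+ 2 + t%:R ^+ 2) / (t%:R * a%:R * b%:R) - 3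
      + dedekind_S R (a%:Z * b%:Z) t.
Proof.
have t_dvd : (t %| a ^ 2 + 1)%N by apply/eqP; rewrite a2_mod_t mod0n.
(* Any common divisor of a and t divides both a and a^2 + 1. *)
have coprime_at : coprime a t.
  by apply: (coprime_dvdr t_dvd); rewrite -mulnn /coprime gcdnMDl gcdn1.
have Sb : dedekind_sum R (t%:Z * astar) b = rademacher_sum R b a t.
  by apply: dedekind_sum_rademacher => //; rewrite mulrCA -modzMmr astarP modzMmr mulr1.
have Sa : dedekind_sum R (t%:Z * bstar) a = rademacher_sum R a b t.
  apply: dedekind_sum_rademacher => //; first by rewrite coprime_sym.
  by rewrite mulrCA -modzMmr bstarP modzMmr mulr1.
(* Since a * (-ab) = -a^2 b is b mod t, the sum that matches [rademacher_sum R t a b] is the one for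
   -ab. Oddness then gives the sign that puts S(ab, t) on the right-hand side. *)
have St : dedekind_sum R (a%:Z * b%:Z) t = - rademacher_sum R t a b.
  rewrite -[LHS]opprK -dedekind_sumN; congr (- _).
  apply: dedekind_sum_rademacher => //; apply/eqP; rewrite eqz_mod_dvd.
  have -> : a%:Z * - (a%:Z * b%:Z) - b%:Z = - b%:Z * (a ^ 2 + 1)%N%:Z.
    by rewrite PoszD expnS expn1 PoszM; ring.
  exact: dvdz_mull.
have a0 : a%:R != 0 :> R by rewrite pnatr_eq0 -lt0n.
have b0 : b%:R != 0 :> R by rewrite pnatr_eq0 -lt0n.
have t0 : t%:R != 0 :> R by rewrite pnatr_eq0 -lt0n.
have := rademacher_reciprocity R a_gt0 b_gt0 t_gt0 coprime_ab coprime_bt coprime_at.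
rewrite /dedekind_S Sa Sb St -addrA => /(canRL (addrK _)) ->.
by field; rewrite a0 b0 t0.
Qed.
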